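(* Let $G$ be a finite nilpotent group that admits a skew-Hadamard difference set. Then $G$ is a $p$-group for some prime $p$.
   Context: Let $G$ be a finite group of order $v$. A $(v,k,\lambda)$ difference set in $G$ is a subset $D\subseteq G$ of size $k$ such that each non-identity element of $G$ can be written as $d_1d_2^{-1}$ with $d_1\neq d_2$ in $D$ in exactly $\lambda$ distinct ways. A skew-Hadamard difference set (SHDS) in $G$ is a difference set $D$ such that $G$ is the disjoint union of $D$, $D^{(-1)}$ and $\{1\}$, where $D^{(-1)}=\{d^{-1}: d\in D\}$. We say that $G$ admits an SHDS if such a $D\subseteq G$ exists. *)

(* Defs.v *)
From HB Require Import structures.
From mathcomp Require Import all_boot all_fingroup all_solvable.

Set Implicit Arguments.
Unset Strict Implicit.
Unset Printing Implicit Defensive.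

Import GroupScope.

Section DifferenceSets.

Variable gT : finGroupType.
Implicit Types (G : {group gT}) (D : {set gT}) (g : gT).

Definition quotient_pairs D g : {set gT * gT} :=
  [set d : gT * gT | [&& d.1 \in D, d.2 \in D, d.1 != d.2 & d.1 * d.2^-1 == g]].

Definition difference_set (v k lambda : nat) G D : Prop :=
  [/\ #|G| = v, D \subset G, #|D| = k &
      forall g, g \in G -> g != 1 -> #|quotient_pairs D g| = lambda].

(* The union is spelled out rather than phrased with [partition], which would
   require the parts to be nonempty and so exclude D = set0 in the trivial
   group.  D^-1 is the setwise inverse [set d^-1 | d in D]. *)
Definition skew_Hadamard_difference_set G D : Prop :=
  [/\ exists v k lambda : nat, difference_set v k lambda G D,
      D :|: D^-1 :|: [set 1] = G,
      [disjoint D & D^-1],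
      [disjoint D & [set 1]] &
      [disjoint D^-1 & [set 1]]].

Definition admits_SHDS G : Prop :=
  exists D : {set gT}, skew_Hadamard_difference_set G D.

End DifferenceSets.

(* Main.v *)
(* Let x = chi(D) - chi(D^-1) for a linear character chi of prime order p, which
   exists for every prime p dividing |G| because G is nilpotent. Then x lies in
   Z[z], with z a primitive p-th root of unity, and x^2 = -|G|. A prime q other
   than p is unramified in Z[z], so its exponent in |G| is even. If two distinct
   primes divided |G|, all the exponents would be even and |G| a square, but
   |G| = 3 mod 4. *)

Require Import Defs.
From HB Require Import structures.
From mathcomp Require Import all_boot all_fingroup all_solvable.
From mathcomp Require Import all_order all_algebra all_field all_character.
From mathcomp Require Import ring zify.

Set Implicit Arguments.
Unset Strict Implicit.
Unset Printing Implicit Defensive.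

Import GroupScope.
Import GRing.Theory Num.Theory.

(** * Character sums over a difference set *)

Section CharacterSums.

Variables (gT : finGroupType) (G : {group gT}) (D : {set gT}).
Variables (R : comNzRingType) (chi : gT -> R).
Hypothesis chi1 : chi 1 = 1%R.
Hypothesis chiM : {in G &, {morph chi : x y / x * y >-> (x * y)%R}}.

Lemma sum_invg :
  (\sum_(g in (D^-1)%g) chi g = \sum_(g in D) chi (g^-1)%g)%R.
Proof.
rewrite (reindex_inj invg_inj); apply: eq_bigl => g.
by rewrite mem_invg invgK.
Qed.

(** Group the pairs [(a, b)] of elements of [D] by [a * b^-1]: the value 1 arises from the [k]
    diagonal pairs, any other element of [G] from [l] pairs. *)
Lemma difference_set_chi v k l : difference_set v k l G D ->
  ((\sum_(g in D) chi g) * (\sum_(g in (D^-1)%g) chi g) =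
    k%:R + l%:R * (\sum_(g in G) chi g - 1))%R.
Proof.
case=> _ sDG cardD cardq.
have DG a : a \in D -> a \in G by apply: (subsetP sDG).
rewrite sum_invg big_distrlr pair_big /=.
rewrite (partition_big (fun d : gT * gT => d.1 * d.2^-1) (mem G)) /=; last first.
  by case=> a b /= /andP[Da Db]; rewrite groupM ?groupV ?DG.
(* Unlike [quotient_pairs], this fibre keeps the diagonal pairs; they all lie over 1. *)
rewrite (eq_bigr (fun g => chi g *+
   #|[set d : gT * gT | (d.1 \in D) && (d.2 \in D) && ((d.1 * d.2^-1)%g == g)]|)%R).
  rewrite (bigD1 1) //= [in RHS](bigD1 1) //= chi1.
  rewrite [X in _ = (_ + _ * X)%R]addrAC subrr add0r mulr_sumr.
  congr (_ + _)%R.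
    congr (_ *+ _)%R; rewrite -cardD -(card_imset (mem D) (f := fun a => (a, a))).
      apply: eq_card => -[a b]; rewrite !inE /= -eq_mulgV1.
      apply/andP/imsetP => [[/andP[Da _] /eqP <-]|[c Dc [-> ->]]].
        by exists a.
      by rewrite Dc.
    by move=> a b [].
  apply: eq_bigr => g /andP[Gg ntg]; rewrite mulr_natl; congr (_ *+ _)%R.
  rewrite -(cardq g Gg ntg); apply: eq_card => -[a b]; rewrite !inE /=.
  rewrite -!andbA; case: (a \in D) => //=; case: (b \in D) => //=.
  have [->|//] := eqVneq a b.
  by rewrite mulgV eq_sym (negPf ntg).
move=> g Gg; rewrite -sumr_const; apply: eq_big => [d|d]; rewrite ?inE //.
by move=> /andP[/andP[Da Db] /eqP <-]; rewrite chiM ?groupV ?DG.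
Qed.

Lemma SHDS_chi_sum : skew_Hadamard_difference_set G D ->
  (\sum_(g in D) chi g + \sum_(g in (D^-1)%g) chi g = \sum_(g in G) chi g - 1)%R.
Proof.
case=> _ defG dDV dD1 dDV1.
have inG: G =i [predU [predU D & D^-1] & [set 1]] by
  move=> g; rewrite -[in LHS]defG !inE.
rewrite [in RHS](eq_bigl _ _ inG).
by rewrite bigU ?disjointU ?dD1 ?dDV1 // bigU // big_set1 chi1 addrK.
Qed.

End CharacterSums.

(** * Parameters of a skew-Hadamard difference set *)

Section SHDSParameters.

Variables (gT : finGroupType) (G : {group gT}) (D : {set gT}).
Hypothesis shdsD : skew_Hadamard_difference_set G D.

(* At the trivial character the two character sums read v = 2k + 1 and
   k^2 = k + l(v - 1). *)
Lemma SHDS_params : (1 < #|G|)%N ->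
  exists l, #|G| = (4 * l + 3)%N /\
    difference_set (4 * l + 3)%N (2 * l + 1)%N l G D.
Proof.
move=> gt1G; have [[v [k [l dsD]]] _ _ _ _] := shdsD.
have [cardG sDG cardD cardq] := dsD.
pose chi (g : gT) : int := 1%R.
have chi1 : chi 1 = 1%R by [].
have chiM : {in G &, {morph chi : x y / x * y >-> (x * y)%R}}.
  by move=> x y _ _; rewrite /chi mulr1.
have := difference_set_chi chi1 chiM dsD.
have := SHDS_chi_sum chi1 shdsD.
have cardDV : #|(D^-1)%g| = k by rewrite card_invg.
rewrite !sumr_const cardDV cardD cardG => e1 e2.
have ev : v = (2 * k + 1)%N by lia.
(* Positivity allows cancelling [k] in [k^2 = k + 2kl]. *)
have k_gt0 : (0 < k)%N by lia.
have ek : k = (2 * l + 1)%N by nia.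
have evl : v = (4 * l + 3)%N by lia.
by exists l; rewrite -evl -ek.
Qed.

(** The two sums add up to -1 and have product [k - l = l + 1], so the square of their difference is
    [1 - 4(l + 1)]. *)
Lemma SHDS_chi_sqr (R : comNzRingType) (chi : gT -> R) :
    (1 < #|G|)%N -> chi 1 = 1%R ->
    {in G &, {morph chi : x y / x * y >-> (x * y)%R}} ->
    (\sum_(g in G) chi g = 0)%R ->
  ((\sum_(g in D) chi g - \sum_(g in (D^-1)%g) chi g) ^+ 2 = - #|G|%:R)%R.
Proof.
move=> gt1G chi1 chiM chi0; have [l [-> dsD]] := SHDS_params gt1G.
have := difference_set_chi chi1 chiM dsD; have := SHDS_chi_sum chi1 shdsD.
rewrite chi0; set d := (\sum_(g in D) _)%R; set d' := (\sum_(g in _) _)%R.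
rewrite (natrD _ (4 * l)) (natrD _ (2 * l)) !natrM => e1 e2.
have -> : ((d - d') ^+ 2 = (d + d') ^+ 2 - 4%:R * (d * d'))%R by ring.
by rewrite e1 e2; ring.
Qed.

End SHDSParameters.

(** * Square roots of negative integers in cyclotomic rings *)

Section SquareRoots.

Local Open Scope ring_scope.

Lemma frobenius_polyFp q s (P : {poly 'F_q}) : prime q ->
  P ^+ (q ^ s) = P \Po 'X^(q ^ s).
Proof.
move=> q_pr.
have charP : [pchar {poly 'F_q}].-nat (q ^ s)%N.
  by rewrite pnatX pnatE // pchar_poly pchar_Fp.
elim/poly_ind: P => [|P c IHP].
  by rewrite comp_poly0 expr0n expn_eq0 eqn0Ngt prime_gt0.
rewrite exprDn_pchar // exprMn IHP comp_polyD comp_polyM comp_polyX comp_polyC.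
rewrite -polyC_exp; congr (_ + _%:P).
elim: s {charP IHP} => [|s IHs]; first by rewrite expr1.
by rewrite expnSr exprM IHs -[X in _ ^+ X](card_Fp q_pr) expf_card.
Qed.

Lemma frobenius_polyZ q s (P : {poly int}) : prime q ->
  exists R : {poly int}, P ^+ (q ^ s) = P \Po 'X^(q ^ s) + q%:Z *: R.
Proof.
move=> q_pr.
have /polyOver_dvdzP[R eR] :
    P ^+ (q ^ s) - (P \Po 'X^(q ^ s)) \is a polyOver (dvdz q).
  apply/polyOverP => i; rewrite (dvdz_pcharf (pchar_Fp q_pr)).
  rewrite -coef_map rmorphB rmorphXn /= map_comp_poly map_polyXn.
  by rewrite frobenius_polyFp // subrr coef0.
by exists R; rewrite -eR addrC subrK.
Qed.

(** The number [- b ^+ 2 = m / q^2] is both rational and an algebraic integer, hence an integer. *)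
Lemma sqr_dvdn_Aint (q m : nat) (b : algC) : (0 < q)%N -> b \in Aint ->
  (q%:R * b) ^+ 2 = - m%:R -> (q ^ 2 %| m)%N.
Proof.
move=> q_gt0 Ab eqb.
have q2_neq0 : (q ^ 2)%:R != 0 :> algC.
  by rewrite pnatr_eq0 expn_eq0 eqn0Ngt q_gt0.
have eb2 : - b ^+ 2 = m%:R / (q ^ 2)%:R.
  apply: (mulIf q2_neq0); rewrite divfK // -[RHS]opprK -eqb natrX; ring.
have /intrP[c ec] : - b ^+ 2 \is a Num.int.
  apply: Cint_rat_Aint; last by rewrite rpredN rpredX.
  by rewrite eb2 rpred_div ?rpred_nat.
rewrite -[(_ %| _)%N]/((Posz (q ^ 2)%N %| Posz m)%Z).
apply/dvdzP; exists c; apply: (@intr_inj algC).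
by rewrite rmorphM /= -ec eb2 !pmulrn divfK.
Qed.

(* By Frobenius, [x ^+ (q ^ s)] is congruent mod [q] to the evaluation of [P]
   at [z ^+ (q ^ s)], and this is [x] again when [q ^ s] is 1 mod [n]. As
   [q] divides [x ^+ 2], it divides [x] in Z[z], and one descends. *)
Lemma logn_sqr_cyclotomic n q m (z : algC) (P : {poly int}) :
    z ^+ n = 1 -> (0 < n)%N -> prime q -> coprime q n -> (0 < m)%N ->
    (map_poly intr P).[z] ^+ 2 = - m%:R ->
  ~~ odd (logn q m).
Proof.
move=> zn1 n_gt0 q_pr co_qn; have q_gt0 := prime_gt0 q_pr.
have Az : z \in Aint by apply: (Aint_unity_root n_gt0); apply/unity_rootP.
have AintP (R : {poly int}) : (map_poly intr R).[z] \in Aint.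
  apply: rpred_horner Az; apply/polyOverP => i.
  by rewrite coef_map /= Aint_int.
elim/ltn_ind: m P => m IHm P m_gt0 eP.
have [|q_ndvd_m] := boolP (q %| m)%N; last first.
  by rewrite lognE q_pr m_gt0 (negPf q_ndvd_m).
case/dvdnP=> m' em.
(* By Euler [N] is 1 mod [n], so [z ^+ N = z]; and [N >= 2] leaves a factor [x ^+ 2 = - m] in
   [x ^+ N]. *)
pose N := (q ^ totient n)%N.
have N_gt1 : (1 < N)%N.
  by rewrite -(exp1n (totient n)) ltn_exp2r ?prime_gt1 ?totient_gt0.
have zN : z ^+ N = z.
  by rewrite -(expr_mod _ zn1) (Euler_exp_totient co_qn) expr_mod.
have [R eR] := frobenius_polyZ (totient n) P q_pr.
pose x := (map_poly intr P).[z].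
have exN : x ^+ N = x + q%:R * (map_poly intr R).[z].
  rewrite /x -horner_exp -rmorphXn /= eR rmorphD /= map_comp_poly map_polyXn.
  by rewrite hornerD horner_comp hornerXn zN map_polyZ hornerZ /= -pmulrn.
(* Obtained by solving [x + q R(z) = x^N = - q m' x^(N - 2)] for [x / q]. *)
pose B := - (m'%:Z *: P ^+ (N - 2) + R).
have exB : x = q%:R * (map_poly intr B).[z].
  have : x ^+ N = - (q%:R * m'%:R) * x ^+ (N - 2).
    rewrite -[in LHS](subnKC N_gt1) exprD eP em natrM; ring.
  rewrite exN /B rmorphN rmorphD /= map_polyZ rmorphXn /=.
  rewrite hornerN hornerD hornerZ horner_exp -/x /= -pmulrn => e.
  by rewrite mulrN mulrDr opprD mulrA -mulNr -e addrK.
have /dvdnP[m2 em2] : (q ^ 2 %| m)%N.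
  by apply: sqr_dvdn_Aint (AintP B) _; rewrite // -exB.
have m2_gt0 : (0 < m2)%N by move: m_gt0; rewrite em2; case: (m2).
rewrite em2 lognM ?expn_gt0 ?q_gt0 // pfactorK // oddD addbF.
(* Dividing [x] by [q] turns [m] into [m2 = m / q^2], which preserves the parity of the exponent. *)
apply: (IHm m2 _ B) => //.
  rewrite em2 -[X in (X < _)%N]muln1 ltn_pmul2l // -(exp1n 2).
  by rewrite ltn_exp2r ?prime_gt1.
have q2_neq0 : (q ^ 2)%:R != 0 :> algC.
  by rewrite pnatr_eq0 expn_eq0 eqn0Ngt q_gt0.
apply: (mulIf q2_neq0); rewrite mulNr -natrM -em2 -eP -/x exB natrX; ring.
Qed.

End SquareRoots.

(** * Linear characters of nilpotent groups *)

Lemma lin_char_prime_order (gT : finGroupType) (G : {group gT}) p :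
    nilpotent G -> prime p -> p %| #|G| ->
  exists2 phi : 'CF(G), phi \is a linear_char & #[phi]%CF = p.
Proof.
move=> nilG p_pr pG.
have defG := nilpotent_pcoreC p nilG; have cardG := dprod_card defG.
have hallP := nilpotent_pcore_Hall p nilG.
have ntP : 'O_p(G) != 1.
  rewrite -cardG_gt1 (card_Hall hallP) p_part_gt1.
  by rewrite mem_primes p_pr pG cardG_gt0.
(* A nontrivial solvable group differs from its derived subgroup, and the index here is a power of
   [p]. *)
have pI : p %| #|'O_p(G) : 'O_p(G)^`(1)|.
  have prP := sol_der1_proper (nilpotent_sol nilG) (pcore_sub _ _) ntP.
  have := proper_subn prP; rewrite -indexg_gt1 => gt1.
  have := pnat_dvd (dvdn_indexg _ _) (pcore_pgroup p G).
  move=> /(_ 'O_p(G)^`(1)%G) /(@p_natP p _) [[|e] e_ind].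
    by rewrite /= in gt1 *; rewrite e_ind in gt1.
  by rewrite e_ind expnS dvdn_mulr.
(* The derived subgroup splits along the direct product of ['O_p(G)] and ['O_p^'(G)], so the indices
   multiply. *)
have pG' : p %| #|G : G^`(1)|.
  have cardG' := dprod_card (der_dprod 1 defG).
  have sK := der_sub 1 'O_p^'(G); have sP := der_sub 1 'O_p(G).
  have eG : (#|G : G^`(1)| =
      #|'O_p(G) : 'O_p(G)^`(1)| * #|'O_p^'(G) : 'O_p^'(G)^`(1)|)%N.
    apply/eqP; rewrite -(eqn_pmul2l (cardG_gt0 G^`(1))) Lagrange ?der_sub //.
    by rewrite -cardG' mulnACA !Lagrange // cardG.
  by rewrite eG dvdn_mulr.
have [linG [cF [_ cardL linF _] [_ _ _ _ ordF]]] := lin_char_group G.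
have [|u _ ordu] := @Cauchy _ p [set: linG]%G p_pr.
  by rewrite cardsT cardL.
by exists (cF u); rewrite ?linF ?ordF.
Qed.

(** Translation by some [g0] with [phi g0 != 1] multiplies the sum by [phi g0] without changing
    it. *)
Lemma sum_lin_char_eq0 (gT : finGroupType) (G : {group gT}) (phi : 'CF(G)) :
  phi \is a linear_char -> phi != 1%R -> (\sum_(g in G) phi g = 0)%R.
Proof.
move=> lin_phi nt_phi.
have [g0 Gg0 phi_g0] : exists2 g, g \in G & phi g != 1%R.
  apply/exists_inP; apply: contraNT nt_phi => /exists_inPn phi1.
  by apply/eqP/cfun_inP => g Gg; rewrite cfun1E Gg; apply/eqP/negPn/phi1.
have: ((1 - phi g0) * (\sum_(g in G) phi g) = 0)%R.
  rewrite mulrBl mul1r [in X in (X - _)%R](reindex_inj (mulgI g0)) mulr_sumr /=.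
  rewrite (eq_big (mem G) (fun g => phi g0 * phi g)%R) ?subrr // => g.
    by rewrite groupMl.
  by rewrite groupMl // => Gg; rewrite lin_charM.
by move/eqP; rewrite mulf_eq0 subr_eq0 eq_sym (negPf phi_g0) => /eqP.
Qed.

(** * Parity of the exponents and conclusion *)

Lemma square_of_even_logn n : (0 < n)%N -> (forall p, ~~ odd (logn p n)) ->
  exists s, n = (s ^ 2)%N.
Proof.
move=> n_gt0 even_n.
exists (\prod_(0 <= p < n.+1) p ^ (logn p n)./2)%N.
rewrite (big_morph (fun m => m ^ 2)%N (fun a b => expnMn a b 2) (exp1n 2)).
rewrite -[LHS](partnT n_gt0); apply: eq_bigr => p _.
rewrite -expnM muln2; congr (_ ^ _)%N.
by rewrite -[LHS]odd_double_half (negPf (even_n p)).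
Qed.

Lemma SHDS_even_logn (gT : finGroupType) (G : {group gT}) p q :
    nilpotent G -> admits_SHDS G -> prime p -> p %| #|G| -> prime q -> q != p ->
  ~~ odd (logn q #|G|).
Proof.
move=> nilG [D shdsD] p_pr pG q_pr neq_qp.
have gt1G : (1 < #|G|)%N.
  by apply: leq_trans (prime_gt1 p_pr) (dvdn_leq (cardG_gt0 G) pG).
have [phi lin_phi ord_phi] := lin_char_prime_order nilG p_pr pG.
have sum_phi : (\sum_(g in G) phi g = 0)%R.
  rewrite sum_lin_char_eq0 // -(expr1 phi) -dvdn_cforder ord_phi dvdn1.
  by rewrite neq_ltn prime_gt1 ?orbT.
have phi_sqr :=
  SHDS_chi_sqr shdsD gt1G (lin_char1 lin_phi) (lin_charM lin_phi) sum_phi.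
have p_gt0 := prime_gt0 p_pr.
have [z prim_z] := C_prim_root_exists p_gt0.
(* The values of [phi] are [p]-th roots of unity, thus powers of [z], so these sums lie in Z[z]. *)
have sumP (A : {set gT}) : A \subset G ->
    exists P : {poly int}, (\sum_(g in A) phi g = (map_poly intr P).[z])%R.
  move=> sAG.
  apply: (big_ind (fun x =>
    exists P : {poly int}, x = (map_poly intr P).[z]%R)).
  - by exists 0%R; rewrite rmorph0 horner0.
  - by move=> _ _ [P ->] [Q ->]; exists (P + Q)%R; rewrite rmorphD hornerD.
  move=> g /(subsetP sAG) Gg.
  have [|k ->] := prim_rootP prim_z (x := phi g).
    by apply: (dvdn_cforderP _) => //; rewrite ord_phi.
  by exists 'X^k%R; rewrite map_polyXn hornerXn.
have sDG : D \subset G by case: shdsD => [[v [k [l []]]]].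
have sDVG : (D^-1)%g \subset G by rewrite -invGid invSg.
have [P eP] := sumP D sDG.
have [Q eQ] := sumP (D^-1)%g sDVG.
apply: (@logn_sqr_cyclotomic p q #|G| z (P - Q)%R) => //.
- exact: prim_expr_order.
- by rewrite prime_coprime // dvdn_prime2.
by rewrite rmorphB hornerD hornerN -eP -eQ.
Qed.

Theorem corollary2p8 (gT : finGroupType) (G : {group gT})
    (nilG : nilpotent G) (shdsG : admits_SHDS G) :
  exists p : nat, prime p /\ p.-group G.
Proof.
have [trG | gt1G] := leqP #|G| 1.
  (* Any prime would do for the trivial group. *)
  exists 2; rewrite (card1_trivg _) ?pgroup1 //; apply/eqP.
  by rewrite eqn_leq trG cardG_gt0.
have p_pr := pdiv_prime gt1G; have pG := pdiv_dvd #|G|.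
exists (pdiv #|G|); split=> //; apply/idPn => not_pG.
have [q q_pr [qG neq_qp]] : exists2 q, prime q & q %| #|G| /\ q != pdiv #|G|.
  have : has (predC1 (pdiv #|G|)) (primes #|G|).
    apply: contraR not_pG => /hasPn allp; apply/pnatP => // q q_pr qG.
    have /allp/negPn// : q \in primes #|G| by rewrite mem_primes q_pr cardG_gt0.
  case/hasP=> q; rewrite mem_primes => /and3P[q_pr _ qG] neq_q.
  by exists q.
have even_log r : ~~ odd (logn r #|G|).
  have [r_pr|r_npr] := boolP (prime r); last by rewrite lognE (negPf r_npr).
  have [->|neq_rp] := eqVneq r (pdiv #|G|).
    (* The roles are exchanged: a character of order [q] controls the exponent of [pdiv #|G|]. *)
    by apply: SHDS_even_logn q_pr qG p_pr _; rewrite // eq_sym.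
  exact: SHDS_even_logn neq_rp.
have [s sqG] := square_of_even_logn (cardG_gt0 G) even_log.
have [D shdsD] := shdsG; have [l [cardG _]] := SHDS_params shdsD gt1G.
have : (s ^ 2 = 4 * l + 3)%N by rewrite -sqG.
(* A square is 0 or 1 mod 4, never 3. *)
rewrite -(odd_double_half s); case: (odd s); nia.
Qed.
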